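(* Let $G$ be a finite simple graph and let $m\geq 1$ be an integer. If $G$ is triangle-free with at least three edges and $c(G)\geq 3$, then $c(\mathsf{M}_m(G))\geq c(G)+3$.
   Context: Graphs are finite, without loops or multiple edges. A cover graph is the underlying undirected graph of the Hasse diagram (covering relation) of a finite partially ordered set. $c(G)=\min\{|F| : F\subseteq E(G) \text{ and } G-F \text{ is a cover graph}\}$, where $G-F$ is obtained by deleting the edges in $F$ (keeping all vertices). Generalized Mycielski graph: let $G$ have vertex set $V_0=\{\langle 0,0\rangle,\langle 0,1\rangle,\ldots,\langle 0,n-1\rangle\}$ and edge set $E_0$. For an integer $m>0$, $\mathsf{M}_m(G)$ has vertex set $V_0\cup\bigcup_{i=1}^m V_i\cup\{u\}$, where $V_i=\{\langle i,j\rangle : 0\leq j\leq n-1\}$, and edge set $E_0\cup\bigcup_{i=1}^m E_i\cup\{\langle m,j\rangle u : 0\leq j\leq n-1\}$, where $E_i=\{\langle i-1,j\rangle\langle i,k\rangle : \langle 0,j\rangle\langle 0,k\rangle\in E_0\}$ for $1\leq i\leq m$ (for each edge of $E_0$ both orders of $j,k$ are used). *)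

(* Defs.v *)
From HB Require Import structures.
From mathcomp Require Import all_boot all_order.
From mathcomp Require Import boolp.

Set Implicit Arguments.
Unset Strict Implicit.
Unset Printing Implicit Defensive.

Import Order.TTheory.

Record sgraph := SGraph {
  vertex :> finType;
  adj : rel vertex;
  adj_sym : symmetric adj;
  adj_irrefl : irreflexive adj
}.

Definition edges (G : sgraph) : {set {set G}} :=
  [set [set p.1; p.2] | p : G * G & adj p.1 p.2].

Definition triangle_free (G : sgraph) : Prop :=
  forall x y z : G, ~~ [&& adj x y, adj y z & adj x z].

Section DeleteEdges.
Variables (G : sgraph) (F : {set {set G}}).

Definition del_adj : rel G :=
  fun x y => adj x y && ([set x; y] \notin F).

Lemma del_adj_sym : symmetric del_adj.
Proof. by move=> x y; rewrite /del_adj adj_sym setUC. Qed.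

Lemma del_adj_irrefl : irreflexive del_adj.
Proof. by move=> x; rewrite /del_adj adj_irrefl. Qed.

Definition del_edges : sgraph := SGraph del_adj_sym del_adj_irrefl.
End DeleteEdges.

Definition covers d (P : finPOrderType d) (x y : P) : bool :=
  (x < y)%O && ~~ [exists z : P, (x < z < y)%O].

Definition is_cover_graph (G : sgraph) : Prop :=
  exists (d : Order.disp_t) (P : finPOrderType d) (f : G -> P),
    bijective f /\
    forall x y : G, adj x y = covers (f x) (f y) || covers (f y) (f x).

Definition cover_after_deleting (G : sgraph) : pred nat := fun k =>
  [exists F : {set {set G}},
    [&& F \subset edges G, #|F| == k & `[< is_cover_graph (del_edges F) >]]].

Lemma edgeless_cover_graph (G : sgraph) :
  (forall x y : G, ~~ adj x y) -> is_cover_graph G.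
Proof.
move=> noE.
have le_refl : reflexive (@eq_op G) by move=> x; exact: eqxx.
have le_anti : antisymmetric (@eq_op G) by move=> x y /andP[/eqP].
have le_trans : transitive (@eq_op G) by move=> y x z /eqP->.
pose P : finPOrderType (Order.Disp tt tt) :=
  HB.pack (Finite.sort G)
    (Order.Le_isPOrder.Build (Order.Disp tt tt) (Finite.sort G)
       le_refl le_anti le_trans).
have noC (a b : P) : covers a b = false.
  by rewrite /covers lt_neqAle; case: eqVneq => //= /negPf nab;
     rewrite [(a <= b)%O]nab.
exists (Order.Disp tt tt), P, (fun x : G => x : P); split; first by exists id.
by move=> x y; rewrite !noC; apply/negbTE/noE.
Qed.

Lemma cover_after_deleting_ex (G : sgraph) :
  exists k, cover_after_deleting G k.
Proof.
exists #|edges G|; apply/existsP; exists (edges G).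
rewrite subxx eqxx /=; apply/asboolP/edgeless_cover_graph => x y /=.
rewrite /del_adj negb_and negbK; case: (boolP (@adj G x y)) => //= xy.
by apply/imsetP; exists (x, y); rewrite ?inE.
Qed.

Definition c (G : sgraph) : nat := ex_minn (cover_after_deleting_ex G).

Section Mycielski.
Variables (m : nat) (G : sgraph).

(* [Some (i, x)] is the copy of [x] on level [i] (levels 0, ..., m), and
   [None] is the apex [u]. *)
Definition myc_adj : rel (option ('I_m.+1 * G)) := fun a b =>
  match a, b with
  | Some (i, x), Some (j, y) =>
      adj x y && [|| (i == 0 :> nat) && (j == 0 :> nat),
                     j == i.+1 :> nat | i == j.+1 :> nat]
  | Some (i, _), None | None, Some (i, _) => i == m :> nat
  | None, None => false
  end.

Lemma myc_adj_sym : symmetric myc_adj.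
Proof.
move=> [[i x]|] [[j y]|] //=; rewrite adj_sym; congr (_ && _).
by rewrite andbC; congr (_ || _); rewrite orbC.
Qed.

Lemma myc_adj_irrefl : irreflexive myc_adj.
Proof. by move=> [[i x]|] //=; rewrite adj_irrefl. Qed.

Definition mycielski : sgraph := SGraph myc_adj_sym myc_adj_irrefl.
End Mycielski.

(* Main.v *)
Require Import Defs.
From mathcomp Require Import all_boot.
From HB Require Import structures.
From mathcomp Require Import all_order all_algebra boolp zify.

(** Let [F] be a set of edges of [M_m(G)] whose deletion leaves a cover graph. Project its
    edges avoiding the apex [u] to a set [B] of edges of [G], and let [J] be the set of
    those [x] for which [F] contains the edge from [<m,x>] to [u].

    In a cover graph every 4-cycle has exactly two arcs in each direction. Hence the signed
    number of arcs along a path from [u] down to a vertex of level 0 or 1 depends only on the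
    end of the path, and comparing this potential with the orientation of level 0 gives a
    2-colouring of [G - B - J]. A triangle-free 3-colourable graph is a cover graph
    (orient the edges along the colours). If [J] has 0 or 1 elements and [B] at least
    3, then 3 or 2 suitable edges of [B] can be put back without losing
    3-colourability, so [c(G) <= |B| - 3] or [c(G) <= |B| - 2].

    Level 0 alone contains at least [c(G)] edges of [F]; so if [|F| < c(G) + 3] then
    [|J| <= 2], and [|J| = 2] forces all other edges of [F] into level 0. Then one edge of
    [B] can be put back: the only obstruction is a 4-cycle [y v a z] with [yz] in [B] and
    [v] in [J], and the potential, which still sees the copies of [yz] between levels
    0 and 1, excludes it. *)

Set Implicit Arguments.
Unset Strict Implicit.
Unset Printing Implicit Defensive.

(** * Cover graphs, orientations and 3-colourings *)

(** The order built is the closure [le] of the edges oriented along [R], not [R] itself, which may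
    have covers that are not edges. It is antisymmetric because its strict part lies inside [R]. *)
Lemma is_cover_graph_of_order (K : sgraph) (R : rel K) :
    transitive R -> irreflexive R ->
    (forall x y : K, adj x y -> R x y || R y x) ->
    (forall x y z : K, adj x y -> R x z -> R z y -> False) ->
  is_cover_graph K.
Proof.
move=> Rt Ri Radj Rcov.
pose d : rel K := fun x y => adj x y && R x y.
pose le : rel K := connect d.
have leR x y : le x y -> x = y \/ R x y.
  move=> /connectP[p]; elim: p x => [|z p IHp] x /=; first by move=> _ ->; left.
  case/andP=> /andP[_ xz] /IHp zp /zp[<-|zy]; right => //.
  exact: Rt xz zy.
have le_refl : reflexive le by move=> x; exact: connect0.
have le_trans : transitive le by exact: connect_trans.
have le_anti : antisymmetric le.
  move=> x y /andP[/leR[//|xy] /leR[//|yx]].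
  by move: (Ri x); rewrite (Rt _ _ _ xy yx).
pose P : finPOrderType (Order.Disp tt tt) :=
  HB.pack (Finite.sort K)
    (Order.Le_isPOrder.Build (Order.Disp tt tt) (Finite.sort K)
       le_refl le_anti le_trans).
have ltR (x y : P) : (x < y)%O -> R x y.
  rewrite Order.POrderTheory.lt_neqAle => /andP[/eqP nxy xy].
  by case: (leR x y xy).
have dlt (x y : P) : d x y -> (x < y)%O.
  move=> dxy; rewrite Order.POrderTheory.lt_neqAle; apply/andP; split.
    by apply/eqP => exy; move: dxy; rewrite /d exy Ri andbF.
  exact: connect1.
have coverE (x y : P) : covers x y = d x y.
  apply/idP/idP.
    case/andP=> ltxy /existsP nz.
    (* A cover is joined by a [d]-path, whose first arc must already end at [y]. *)
    have := Order.POrderTheory.ltW ltxy => /connectP[[|z p]] /=.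
      by move=> _ exy; rewrite exy Order.POrderTheory.ltxx in ltxy.
    case/andP=> dxz zp ey; have [ezy|nzy] := eqVneq z y; first by rewrite -ezy.
    case: nz; exists (z : P); rewrite (dlt _ _ dxz) /=.
    rewrite Order.POrderTheory.lt_neqAle nzy; apply/connectP.
    by exists p.
  move=> dxy; rewrite /covers dlt //=; apply/existsP=> -[z /andP[/ltR xz /ltR zy]].
  by case/andP: dxy => axy _; exact: (Rcov _ _ _ axy xz zy).
exists (Order.Disp tt tt), P, (fun x : K => x : P); split; first by exists id.
move=> x y; rewrite !coverE /d [adj y x]adj_sym -andb_orr.
by case: (boolP (adj x y)) => //= /Radj ->.
Qed.

Definition three_colorable (T : Type) (K : rel T) : Prop :=
  exists2 col : T -> nat, forall x, col x < 3 & forall x y, K x y -> col x != col y.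

(** With three colours an increasing path has at most two arcs, so [R] is the transitive closure of
    [d]. A vertex between the ends of an edge would complete a triangle. *)
Lemma is_cover_graph_three_colorable (K : sgraph) :
  triangle_free K -> three_colorable (@adj K) -> is_cover_graph K.
Proof.
move=> tf [col col3 colP].
pose d : rel K := fun x y => adj x y && (col x < col y).
pose R : rel K := fun x y => d x y || [exists z, d x z && d z y].
have Rlt x y : R x y -> col x < col y.
  case/orP=> [/andP[]//|/existsP[z /andP[/andP[_ xz] /andP[_ zy]]]].
  exact: ltn_trans xz zy.
have R2 x z y : R x z -> R z y -> d x z /\ d z y.
  move=> xz zy; have := Rlt _ _ xz; have := Rlt _ _ zy; have := col3 y.
  by move: xz zy => /orP[->|/existsP[t /andP[/andP[_ ?] /andP[_ ?]]]]
     /orP[->|/existsP[s /andP[/andP[_ ?] /andP[_ ?]]]] //; lia.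
apply: (@is_cover_graph_of_order _ R).
- move=> z x y xz zy; have [dxz dzy] := R2 _ _ _ xz zy.
  by apply/orP; right; apply/existsP; exists z; rewrite dxz.
- by move=> x; apply/negP => /Rlt; rewrite ltnn.
- move=> x y xy; have := colP _ _ xy; rewrite /R /d [adj y x]adj_sym xy /=.
  by rewrite neq_ltn => /orP[->|->] //; rewrite orbT.
- move=> x y z xy xz zy; have [/andP[axz _] /andP[azy _]] := R2 _ _ _ xz zy.
  by move: (tf x z y); rewrite axz azy xy.
Qed.

Lemma c_le (G : sgraph) (F : {set {set G}}) :
  F \subset edges G -> is_cover_graph (del_edges F) -> c G <= #|F|.
Proof.
move=> sF cF; rewrite /c; case: ex_minnP => k _; apply; apply/existsP; exists F.
by rewrite sF eqxx; apply/asboolP.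
Qed.

Lemma c_attained (G : sgraph) : exists2 F : {set {set G}},
  #|F| = c G & F \subset edges G /\ is_cover_graph (del_edges F).
Proof.
rewrite /c; case: ex_minnP => k /existsP[F /and3P[sF /eqP <- /asboolP cF]] _.
by exists F.
Qed.

Lemma c_le_three_colorable (G : sgraph) (F : {set {set G}}) :
    triangle_free G -> F \subset edges G ->
    three_colorable (fun x y : G => adj x y && ([set x; y] \notin F)) ->
  c G <= #|F|.
Proof.
move=> tf sF col; apply: c_le => //; apply: is_cover_graph_three_colorable => //.
move=> x y z; apply/and3P => -[/andP[xy _] /andP[yz _] /andP[xz _]].
by move: (tf x y z); rewrite xy yz xz.
Qed.

(** After three arcs in one direction, the fourth edge either closes a directed cycle or joins the
    ends of a chain, and so is not a cover. Vertices may repeat, which the potential argument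
    uses. *)
Lemma cover_square (G : sgraph) d (P : finPOrderType d) (f : G -> P) :
    (forall x y, adj x y = covers (f x) (f y) || covers (f y) (f x)) ->
  forall x y z t, adj x y -> adj y z -> adj z t -> adj t x ->
  ((f x < f y)%O + (f y < f z)%O + (f z < f t)%O + (f t < f x)%O = 2)%N.
Proof.
move=> fP.
have lt1 x y : adj x y -> (f y < f x)%O = ~~ (f x < f y)%O.
  rewrite fP => /orP[/andP[lt _]|/andP[lt _]]; rewrite lt //=;
  by rewrite Order.POrderTheory.lt_gtF.
have tr3 x y z t : adj t x -> (f x < f y)%O -> (f y < f z)%O -> (f z < f t)%O -> False.
  move=> tx xy yz zt.
  have yt := Order.POrderTheory.lt_trans yz zt.
  have xt := Order.POrderTheory.lt_trans xy yt.
  move: tx; rewrite fP => /orP[/andP[tx _]|/andP[_ /existsP[]]].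
    by move: (Order.POrderTheory.lt_trans tx xt); rewrite Order.POrderTheory.ltxx.
  by exists (f y); rewrite xy.
move=> x y z t xy yz zt tx.
move: (lt1 _ _ xy) (lt1 _ _ yz) (lt1 _ _ zt) (lt1 _ _ tx).
have yx : adj y x by rewrite adj_sym.
have zy : adj z y by rewrite adj_sym.
have tz : adj t z by rewrite adj_sym.
have xt : adj x t by rewrite adj_sym.
move: (tr3 x y z t tx) (tr3 y z t x xy) (tr3 z t x y yz) (tr3 t x y z zt).
move: (tr3 x t z y yx) (tr3 t z y x xt) (tr3 z y x t tz) (tr3 y x t z zy).
case: (f x < f y)%O; case: (f y < f z)%O; case: (f z < f t)%O; case: (f t < f x)%O => //;
move=> H1 H2 H3 H4 H5 H6 H7 H8 E1 E2 E3 E4; rewrite ?E1 ?E2 ?E3 ?E4 in H1 H2 H3 H4 H5 H6 H7 H8;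
by case: (H1 isT isT isT) || case: (H2 isT isT isT) || case: (H3 isT isT isT) ||
  case: (H4 isT isT isT) || case: (H5 isT isT isT) || case: (H6 isT isT isT) ||
  case: (H7 isT isT isT) || case: (H8 isT isT isT).
Qed.

(** * 3-colouring triangle-free graphs that are nearly bipartite *)

Section Colorings.
Variables (T : finType) (K : rel T).
Hypothesis K_sym : symmetric K.
Hypothesis K_irr : irreflexive K.
Hypothesis K_tf : forall x y z, K x y -> K y z -> K x z -> False.

Lemma three_colorable_indep (s : T -> bool) (S : pred T) :
    (forall x y, K x y -> S x -> S y -> False) ->
    (forall x y, K x y -> ~~ S x -> ~~ S y -> s x != s y) ->
  three_colorable K.
Proof.
move=> indS propS; exists (fun x => if S x then 2 else s x) => [x|x y xy].
  by case: (S x) => //; case: (s x).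
have := indS _ _ xy; have := propS _ _ xy.
case: (S x); case: (S y) => //= H1 H2; first by case: H2.
- by case: (s y).
- by case: (s x).
- by move: (H1 isT isT); case: (s x); case: (s y).
Qed.

(** The third colour goes to [v] and to one end of each monochromatic edge, chosen not adjacent to
    [v]. The common side [b] settles the case where the two chosen ends are adjacent. *)
Lemma three_colorable_vertex (s : T -> bool) (v : T) (e1 e2 : {set T}) (b : bool) :
    (forall x y, K x y -> x != v -> y != v -> s x = s y ->
       s x = b /\ ([set x; y] = e1 \/ [set x; y] = e2)) ->
  three_colorable K.
Proof.
move=> bad.
have pickN x y : K x y -> exists x' y', [/\ K x' y', ~~ K x' v & [set x'; y'] = [set x; y]].
  move=> xy; have [xv|nxv] := boolP (K x v); last by exists x, y.
  exists y, x; rewrite K_sym setUC; split=> //; apply/negP => yv; exact: K_tf xy yv xv.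
have memv x y x' y' : [set x'; y'] = [set x; y] -> x != v -> y != v -> s x = s y ->
    [/\ x' != v, y' != v & s x' = s y'].
  move=> e xv yv sxy.
  have /set2P Hx : x' \in [set x; y] by rewrite -e set21.
  have /set2P Hy : y' \in [set x; y] by rewrite -e set22.
  by case: Hx => ->; case: Hy => ->.
have badP (S : pred T) : (exists x y, [/\ K x y, s x = s y & ~~ S x && ~~ S y]) \/
   (forall x y, K x y -> ~~ S x -> ~~ S y -> s x != s y).
  have [/existsP[x /existsP[y /and3P[xy /eqP sxy xS]]]|/existsPn nex] :=
      boolP [exists x, exists y, [&& K x y, s x == s y & ~~ S x && ~~ S y]].
    by left; exists x, y.
  right=> x y xy xS yS; have /existsPn/(_ y) := nex x.
  by rewrite xy xS yS /= andbT.
have [[x [y [xy sxy /andP[xv yv]]]]|] := badP (pred1 v); last first.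
  move=> H; apply: (three_colorable_indep (s := s) (S := pred1 v)) => // x y xy /eqP ex /eqP ey.
  by move: xy; rewrite ex ey K_irr.
have [x1 [y1 [xy1 x1v e1E]]] := pickN _ _ xy.
have [x1nv y1nv s1] := memv _ _ _ _ e1E xv yv sxy.
(* Either [v] and [x1] already meet every monochromatic edge, or some [zt] avoids both. *)
have [[z [t [zt szt /andP[]]]]|] := badP (pred2 v x1); last first.
  move=> H; apply: (three_colorable_indep (s := s) (S := pred2 v x1)) => // p q pq.
  case/pred2P=> ep /pred2P[] eq; move: pq x1v; rewrite ep eq ?K_irr // => h.
    by rewrite K_sym h.
  by rewrite h.
rewrite !negb_or => /andP[zv zx1] /andP[tv tx1].
have [x2 [y2 [xy2 x2v e2E]]] := pickN _ _ zt.
have [x2nv y2nv s2] := memv _ _ _ _ e2E zv tv szt.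
have x1N : x1 \notin [set x2; y2].
  by rewrite e2E !inE negb_or eq_sym zx1 eq_sym tx1.
have [sb1 E1] := bad _ _ xy1 x1nv y1nv s1.
have [sb2 E2] := bad _ _ xy2 x2nv y2nv s2.
(* The two edges found differ, so they are [e1] and [e2] in some order. *)
have all_bad p q : K p q -> p != v -> q != v -> s p = s q ->
    [set p; q] = [set x1; y1] \/ [set p; q] = [set x2; y2].
  move=> pq pv qv spq; have [_ E] := bad _ _ pq pv qv spq.
  have ne : [set x1; y1] <> [set x2; y2].
    by move=> e; move: x1N; rewrite -e set21.
  by case: E1; case: E2; case: E; intuition congruence.
(* If [x1] and [x2] are adjacent, both lie on side [b], so their edge is monochromatic and
   [x2 = y1]; then [v] and [x2] meet all monochromatic edges. *)
have ind2 : three_colorable K \/ ~~ K x1 x2.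
  have [x12|] := boolP (K x1 x2); last by right.
  left; have x2y1 : x2 = y1.
    have /(_ x1nv x2nv) [] := all_bad _ _ x12; first by rewrite sb1.
      move=> e; have /set2P[e'|//] : x2 \in [set x1; y1] by rewrite -e set22.
      by move: x1N; rewrite -e' set21.
    by move=> e; move: x1N; rewrite -e set21.
  apply: (three_colorable_indep (s := s) (S := pred2 v x2)) => [p q pq|p q pq].
    case/pred2P=> ep /pred2P[] eq; move: pq x2v; rewrite ep eq ?K_irr // => h.
      by rewrite K_sym h.
    by rewrite h.
  rewrite /= !negb_or => /andP[pv px2] /andP[qv qx2]; apply/eqP => spq.
  have H : x2 \in [set p; q].
    by case: (all_bad _ _ pq pv qv spq) => ->; rewrite !inE ?x2y1 eqxx ?orbT.
  by move: H; rewrite !inE ![x2 == _]eq_sym (negPf px2) (negPf qx2).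
case: ind2 => // nx12.
apply: (three_colorable_indep (s := s) (S := [pred p | [|| p == v, p == x1 | p == x2]])).
  move=> p q pq /= Hp Hq; move: pq x1v x2v nx12.
  case/or3P: Hp => /eqP->; case/or3P: Hq => /eqP->; rewrite ?K_irr //;
  by rewrite ?[K v _]K_sym ?[K x2 x1]K_sym => ->.
move=> p q pq /=; rewrite !negb_or => /and3P[pv px1 px2] /and3P[qv qx1 qx2].
apply/eqP => spq.
have [] := all_bad _ _ pq pv qv spq => e.
  have : x1 \in [set p; q] by rewrite e set21.
  by rewrite !inE ![x1 == _]eq_sym (negPf px1) (negPf qx1).
have : x2 \in [set p; q] by rewrite e set21.
by rewrite !inE ![x2 == _]eq_sym (negPf px2) (negPf qx2).
Qed.

(* Off [v] and [w], the side [s p != s y] is coloured [0]; on the other side [N(v)] is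
   coloured [1], [N(w)] is coloured [2], and the remaining vertices are free to split [yz]. *)
Lemma three_colorable_adjacent (s : T -> bool) (v w y z : T) :
    K v w ->
    (forall p q, K p q -> p \notin [set v; w] -> q \notin [set v; w] ->
       s p = s q -> [set p; q] = [set y; z]) ->
  three_colorable K.
Proof.
move=> vw bad.
pose col p := if p == v then 2 else if p == w then 1 else
  if s p != s y then 0 else if K p v then 1 else if K p w then 2 else
  (* A free end of [yz] avoids the colour forced on the other end; if both are free they get 1 and
     2. *)
  if p == y then (if K z v then 2 else 1) else
  if p == z then (if K y v then 2 else if K y w then 1 else 2) else 1.
have col_avoid p : p \notin [set v; w] -> (col p == 0) = (s p != s y).
  rewrite !inE negb_or /col => /andP[/negPf-> /negPf->].
  by case: (s p != s y) => //; case: (K p v); case: (K p w); case: (p == y); case: (K z v); case: (p == z); case: (K y v); case: (K y w).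
have wv : K w v by rewrite K_sym.
have nvw : v != w by apply/eqP => e; move: vw; rewrite e K_irr.
have colv p : K v p -> col p < 2.
  move=> vp; rewrite /col [K p v]K_sym vp.
  have [e|_] := eqVneq p v; first by rewrite e K_irr in vp.
  by case: ifP => // _; case: ifP.
have colw p : K w p -> p != v -> col p != 1.
  move=> wp npv; rewrite /col (negPf npv).
  have [e|_] := eqVneq p w; first by rewrite e K_irr in wp.
  case: ifP => // _; case: ifP => [pv|_]; first by case: (K_tf vw wp); rewrite K_sym.
  by rewrite [K p w]K_sym wp.
have colvE : col v = 2 by rewrite /col eqxx.
have colwE : col w = 1 by rewrite /col eq_sym (negPf nvw) eqxx.
have coll p q : K p q -> p \in [set v; w] -> col p != col q.
  move=> pq /set2P[] e; subst p; first by rewrite colvE; have := colv _ pq; case: (col q) => [|[]].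
  have [->|qv] := eqVneq q v; first by rewrite colvE colwE.
  by rewrite colwE eq_sym colw.
exists col => [p|p q pq]; first by rewrite /col; case: (p == v); case: (p == w); case: (s p != s y) => //; case: (K p v); case: (K p w); case: (p == y); case: (K z v); case: (p == z); case: (K y v); case: (K y w).
have [/(coll _ _ pq) //|pN] := boolP (p \in [set v; w]).
have [qI|qN] := boolP (q \in [set v; w]).
  by rewrite eq_sym; apply: coll; rewrite // K_sym.
have [spq|spq] := eqVneq (s p) (s q); last first.
  apply/eqP => e; have := col_avoid _ pN; rewrite e col_avoid // => e1.
  by move: spq e1; case: (s p); case: (s q); case: (s y).
have edge a b : K a b -> a \notin [set v; w] -> b \notin [set v; w] -> a = y -> b = z -> s a = s b ->
    col a != col b.
  rewrite !inE !negb_or => ab /andP[/negPf av /negPf aw] /andP[/negPf bv /negPf bw] ea eb sab.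
  have nab : b == a = false by apply/eqP => e1; rewrite e1 K_irr in ab.
  rewrite /col av aw bv bw -ea -eb sab !eqxx nab.
  have Tv : K a v -> K b v -> False by move=> av' bv'; exact: K_tf ab bv' av'.
  have Tw : K a w -> K b w -> False by move=> av' bv'; exact: K_tf ab bv' av'.
  by move: Tv Tw; case: (K a v); case: (K b v); case: (K a w); case: (K b w) => // H1 H2;
     case: (H1 isT isT) || case: (H2 isT isT).
have e := bad _ _ pq pN qN spq.
have npq : p != q by apply/eqP => e1; rewrite e1 K_irr in pq.
have /set2P[py|pz] : p \in [set y; z] by rewrite -e set21.
  have /set2P[qy|qz] : q \in [set y; z] by rewrite -e set22.
    by rewrite py qy eqxx in npq.
  exact: edge.
have /set2P[qy|qz] : q \in [set y; z] by rewrite -e set22.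
  by rewrite eq_sym; apply: edge; rewrite // K_sym.
by rewrite pz qz eqxx in npq.
Qed.

Lemma three_colorable_nonadjacent (s : T -> bool) (v w y z : T) :
    ~~ K v w -> K y v ->
    (forall a, K y a -> K a w -> s a = s y) ->
    (forall p q, K p q -> p \notin [set v; w] -> q \notin [set v; w] ->
       s p = s q -> [set p; q] = [set y; z]) ->
  three_colorable K.
Proof.
move=> nvw yv yw bad.
have nwv : ~~ K w v by rewrite K_sym.
(* [y] changes side, its neighbours across join [v] and [w] in the third colour. *)
apply: (three_colorable_indep (s := fun p => if p == y then ~~ s y else s p)
   (S := [pred p | (p \in [set v; w]) || K y p && (s p != s y)])).
  (* A recoloured neighbour of [y] is not adjacent to [v], by triangle-freeness, nor to [w], by
     [yw]. *)
  have aux p q : K p q -> p \in [set v; w] -> (q \in [set v; w]) || K y q && (s q != s y) -> False.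
    move=> pq /set2P[] e; subst p; case/orP=> [/set2P[] e|/andP[yq sq]]; subst.
    - by rewrite K_irr in pq.
    - by rewrite pq in nvw.
    - exact: K_tf yv pq yq.
    - by rewrite pq in nwv.
    - by rewrite K_irr in pq.
    - by rewrite yw ?eqxx // K_sym in sq.
  move=> p q pq /= /orP[/(aux _ _ pq)//|/andP[yp sp]] /orP[qI|/andP[yq sq]].
    by apply: (aux q p _ qI); [rewrite K_sym | rewrite yp sp orbT].
  exact: K_tf yp pq yq.
move=> p q pq /=; rewrite !negb_or => /andP[pN pS] /andP[qN qS].
case: (p =P y) pS => [ep|/eqP npy] pS.
  subst p; case: (q =P y) qS => [ey|_]; first by rewrite ey K_irr in pq.
  by rewrite pq /= negbK => /eqP ->; case: (s y).
case: (q =P y) qS => [ey|/eqP nqy] qS.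
  by subst q; rewrite K_sym pq /= negbK in pS; rewrite (eqP pS); case: (s y).
apply/eqP => spq; have : y \in [set p; q] by rewrite (bad _ _ pq) // set21.
by rewrite !inE eq_sym (negPf npy) eq_sym (negPf nqy).
Qed.

(** Suppose [v] and [w] are not adjacent and [yz] is monochromatic. An end of [yz] adjacent to
    neither can join them in the third colour. Otherwise, say, [y] is adjacent to [v] and [z] to
    [w]; recolouring around [y] or around [z] works unless there are vertices [b] and [a] across,
    completing the configuration that the last hypothesis forbids. *)
Lemma three_colorable_two_vertices (s : T -> bool) (v w : T) (e : {set T}) :
    (forall p q, K p q -> p \notin [set v; w] -> q \notin [set v; w] ->
       s p = s q -> [set p; q] = e) ->
    (forall y z a b, [/\ y \notin [set v; w], z \notin [set v; w],
         a \notin [set v; w] & b \notin [set v; w]] ->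
       [/\ K y z, K y v, K v a, K a z & K y b] ->
       s y = s z -> s a != s z -> s b != s y -> False) ->
  three_colorable K.
Proof.
move=> bad hex.
have [/existsP[y /existsP[z /and4P[yz yN zN /eqP syz]]]|/existsPn nex] :=
    boolP [exists y, exists z,
      [&& K y z, y \notin [set v; w], z \notin [set v; w] & s y == s z]]; last first.
  have nobad p q : K p q -> p \notin [set v; w] -> q \notin [set v; w] -> s p != s q.
    by move=> pq pN qN; have /existsPn/(_ q) := nex p; rewrite pq pN qN.
  have [vw|nvw] := boolP (K v w).
    apply: (three_colorable_adjacent (s := s) (y := v) (z := w) vw) => p q pq pN qN spq.
    by have := nobad _ _ pq pN qN; rewrite spq eqxx.
  apply: (three_colorable_indep (s := s) (S := mem [set v; w])) => [p q pq|p q pq].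
    by case/set2P=> e1 /set2P[] e2; subst; move: pq; rewrite ?K_irr // ?(negPf nvw) // K_sym (negPf nvw).
  exact: nobad.
have {}bad p q : K p q -> p \notin [set v; w] -> q \notin [set v; w] ->
       s p = s q -> [set p; q] = [set y; z].
  by move=> pq pN qN spq; rewrite (bad y z) // (bad p q).
have [vw|nvw] := boolP (K v w).
  exact: (three_colorable_adjacent (s := s) (y := y) (z := z) vw).
have nwv : ~~ K w v by rewrite K_sym.
have isolated p : p \in [set y; z] -> ~~ K p v -> ~~ K p w -> three_colorable K.
  move=> pI pv pw.
  apply: (three_colorable_indep (s := s) (S := mem [set v; w; p])) => [a b ab|a b ab] /=.
    rewrite !inE -!orbA => /or3P[] /eqP e1 /or3P[] /eqP e2; subst; move: ab; rewrite ?K_irr //;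
    by rewrite ?(negPf nvw) ?(negPf nwv) ?(negPf pv) ?(negPf pw) // K_sym ?(negPf pv) ?(negPf pw).
  rewrite !in_setU ![_ \in [set p]]in_set1 -!in_setU !negb_or => /andP[aN ap] /andP[bN bp].
  apply/eqP => sab; move: pI; rewrite -(bad a b) // !inE ![p == _]eq_sym.
  by rewrite (negPf ap) (negPf bp).
wlog yv : y z yz yN zN syz bad isolated / K y v.
  move=> H; have [yv|yv] := boolP (K y v); first exact: (H y z).
  have zy : K z y by rewrite K_sym.
  have [zv|zv] := boolP (K z v).
    apply: (H z y) => // [p q *|p]; first by rewrite [RHS]setUC; apply: bad.
    by rewrite setUC; apply: isolated.
  have [yw|yw] := boolP (K y w); last by apply: (isolated y); rewrite // set21.
  apply: (isolated z) => //; first by rewrite set22.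
  by apply/negP => zw; exact: K_tf yz zw yw.
have zv : ~~ K z v by apply/negP => zv; exact: K_tf yz zv yv.
have [zw|zw] := boolP (K z w); last by apply: (isolated z); rewrite // set22.
have escape p q r : (forall a, K p a -> K a q -> s a = s r) \/
    exists2 a, s a != s r & K p a /\ K a q.
  have [/existsP[a /and3P[sa pa aq]]|/existsPn nexa] :=
      boolP [exists a, [&& s a != s r, K p a & K a q]]; first by right; exists a.
  by left=> a pa aq; have := nexa a; rewrite pa aq !andbT negbK => /eqP.
have [ybad|[b sb [yb bw]]] := escape y w y.
  exact: (three_colorable_nonadjacent (s := s) (v := v) (w := w) (z := z) nvw yv).
have [zbad|[a sa [za av]]] := escape z v z.
  apply: (three_colorable_nonadjacent (s := s) (v := w) (w := v) (z := y) nwv zw) => //.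
  by move=> p q pq; rewrite [[set w; v]]setUC [[set z; y]]setUC; apply: bad.
have neigh p : K p v || K p w -> p \notin [set v; w].
  by move=> H; apply/set2P => -[] e1; move: H; rewrite e1 K_irr ?orbF ?(negPf nvw) ?(negPf nwv).
case: (hex y z a b) => //; last by split; rewrite // K_sym.
by split=> //; apply: neigh; rewrite ?av ?bw ?orbT.
Qed.

End Colorings.

(** * The potential and the 2-colouring of level 0 *)

Section Potential.
Local Open Scope ring_scope.

(** Turns path-independence into a potential; the default 0 is taken only where no path arrives. *)
Lemma choose_function (T : finType) (R : rel T) (h : T -> T -> int) :
    (forall x y y', R x y -> R x y' -> h x y = h x y') ->
  exists f : T -> int, forall x y, R x y -> f x = h x y.
Proof.
move=> hR; exists (fun x => if [pick y | R x y] is Some y then h x y else 0) => x y xy.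
by case: pickP => [y' xy'|/(_ y)]; [exact: hR | rewrite xy].
Qed.

Variables (T : finType) (W : Type) (N : W -> W -> Prop) (b : W -> W -> int).
Hypothesis N_sym : forall p q, N p q -> N q p.
Hypothesis b_anti : forall p q, N p q -> b p q + b q p = 1.
Hypothesis b_square : forall p q r t, N p q -> N q r -> N r t -> N t p ->
  b p q + b q r + b r t + b t p = 2.

(** [U] stands for edges whose copies between consecutive levels all survive, [E] for those that
    survive on level 0 as well; [J] marks the possibly missing apex edges. *)
Variables (V : nat -> T -> W) (u : W) (m : nat) (U E : rel T) (J : pred T).
Hypothesis m_gt0 : (0 < m)%N.
Hypothesis U_sym : symmetric U.
Hypothesis E_sym : symmetric E.
Hypothesis E_sub : forall x y, E x y -> U x y.
Hypothesis N_level0 : forall x y, E x y -> N (V 0 x) (V 0 y).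
Hypothesis N_up : forall i x y, (i < m)%N -> U x y -> N (V i x) (V i.+1 y).
Hypothesis N_top : forall x, ~~ J x -> N (V m x) u.

(* When an apex edge is missing at [x], the copies of [x] on the levels
   [m], [m - 2], [m - 4], etc., have no well-defined potential. *)
Let A i x := odd (m - i) || ~~ J x.

(* [b] takes the values [0] and [1] rather than [-1] and [1]: this shifts the potential by
   half the level and keeps it integral whatever the parity of the level. *)
Lemma level_potential i : (i < m)%N -> exists f g : T -> int,
  forall x y, U x y -> A i x -> A i.+1 y -> f x = g y + b (V i.+1 y) (V i x).
Proof.
(* The induction descends from level [m], with [t] equal to [m - i.+1]. *)
move=> im; have -> : i = (m - (m - i.+1).+1)%N by lia.
have : (m - i.+1 < m)%N by lia.
move: (m - i.+1)%N => {i im} t; elim: t => [|t IHt] tm.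
  (* On level [m] the potential is read off the apex edge; squares through [u] make it well defined
     on level [m - 1]. *)
  pose g y := b u (V m y).
  have mE : (m - 1).+1 = m by lia.
  have Am x : A m x = ~~ J x by rewrite /A subnn.
  have [|f fP] := @choose_function T (fun x y => U x y && ~~ J y)
     (fun x y => g y + b (V m y) (V (m - 1) x)).
    move=> x y y' /andP[xy Jy] /andP[xy' Jy'].
    have N1 := N_up (i := (m - 1)%N) (x := x) (y := y).
    have N2 := N_up (i := (m - 1)%N) (x := x) (y := y').
    rewrite mE in N1 N2.
    have {}N1 := N1 ltac:(lia) xy; have {}N2 := N2 ltac:(lia) xy'.
    have := b_square (N_sym (N_top Jy)) (N_sym N1) N2 (N_top Jy').
    have := b_anti N2; have := b_anti (N_top Jy'); rewrite /g; lia.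
  by exists f, g => x y xy _; rewrite mE Am => Jy; rewrite (fP x y) ?xy.
have {IHt}[|f [g fg]] := IHt; first by lia.
set i := (m - t.+2)%N; have E1 : (m - t.+1)%N = i.+1 by lia.
rewrite E1 in fg; have im : (i.+1 < m)%N by lia.
have [|f' f'P] := @choose_function T (fun x y => [&& U x y, A i x & A i.+1 y])
     (fun x y => f y + b (V i.+1 y) (V i x)).
  move=> x y y' /and3P[xy Ax Ay] /and3P[xy' _ Ay'].
  (* [A] depends on the level only through its parity, so the previous potential applies to the copy
     of [x] two levels up, the fourth corner of the square. *)
  have Ax2 : A i.+2 x by move: Ax; rewrite /A (_ : (m - i = (m - i.+2).+2)%N); [rewrite /= negbK | lia].
  have [yx y'x] : U y x /\ U y' x by rewrite ![U _ x]U_sym.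
  have im' : (i < m)%N by lia.
  have N1 := N_up im' xy; have N2 := N_up im' xy'.
  have N3 := N_up im yx; have N4 := N_up im y'x.
  have := b_square (N_sym N1) N2 N4 (N_sym N3).
  have := fg y x yx Ay Ax2; have := fg y' x y'x Ay' Ax2.
  by have := b_anti N1; have := b_anti N2; have := b_anti N3; have := b_anti N4; lia.
by exists f', f => x y xy Ax Ay; rewrite (f'P x y) // xy Ax Ay.
Qed.

(** Level 0 carries two potentials: [p], reached from level 1, and [q], reached by a last step
    inside level 0. Comparing them gives the colouring. The second conclusion concerns an edge [yz]
    that may be missing on level 0 only. *)
Lemma level0_coloring : exists s : T -> bool,
  (forall x y, E x y -> ~~ J x -> ~~ J y -> s x != s y) /\
  (forall j y z p q, [/\ ~~ J y, ~~ J z, ~~ J p & ~~ J q] ->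
     [/\ E y j, E j p, E p z & E y q] -> U y z -> s y != s z).
Proof.
have [p [r pr]] := level_potential m_gt0.
have AJ i x : ~~ J x -> A i x by rewrite /A => ->; rewrite orbT.
(* The copies of [y] on levels 0 and 1 are both joined to those of [x] and [x'] on level 0, and this
   square makes [q] well defined. *)
have [|q qP] := @choose_function T (fun y x => [&& E y x, A 0 x & A 1 y])
     (fun y x => p x + b (V 0 x) (V 0 y)).
  move=> y x x' /and3P[yx Ax Ay] /and3P[yx' Ax' _].
  have [xy x'y] : E x y /\ E x' y by rewrite ![E _ y]E_sym.
  have N1 := N_up m_gt0 (E_sub xy); have N2 := N_up m_gt0 (E_sub x'y).
  have := b_square (N_level0 xy) (N_level0 yx') N2 (N_sym N1).
  have := pr x y (E_sub xy) Ax Ay; have := pr x' y (E_sub x'y) Ax' Ay.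
  by have := b_anti N1; have := b_anti N2; have := b_anti (N_level0 xy);
     have := b_anti (N_level0 yx'); lia.
have flip x y : E x y -> ~~ J x -> ~~ J y -> q x - p x + (q y - p y) = 1.
  move=> xy Jx Jy; have yx : E y x by rewrite E_sym.
  rewrite (qP x y) ?(qP y x) ?xy ?yx ?AJ //.
  by have := b_anti (N_level0 xy); lia.
(* By [flip], exactly one end of each edge satisfies [p < q]. *)
exists (fun x => q x > p x); split=> [x y xy Jx Jy|j y z a d [Jy Jz Ja Jd] [yj ja az yd] yz].
  by have := flip _ _ xy Jx Jy; case: (boolP (p x < q x)); case: (boolP (p y < q y)) => //=; lia.
(* Since [az] is in [E], [a] and [z] are already separated; [y] must agree with [a]. *)
suff eq_ya : q y - p y = q a - p a.
  by have := flip _ _ az Ja Jz; case: (boolP (p y < q y)); case: (boolP (p z < q z)) => //=; lia.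
have jy : E j y by rewrite E_sym.
have aj : E a j by rewrite E_sym.
have za : E z a by rewrite E_sym.
have dy : E d y by rewrite E_sym.
have zy : U z y by rewrite U_sym.
(* Although [j] may lie in [J], it has a usable [p] for odd [m] and a usable [q] for even [m]. *)
have [A0|A1] : (forall x, A 0 x) \/ (forall x, A 1 x).
  rewrite /A; case: (m) m_gt0 => // k _; rewrite subSS !subn0 /=.
  by case: (odd k); [right | left].
- have qy : q y = p j + b (V 0 j) (V 0 y) by apply: qP; rewrite yj A0 AJ.
  have qa : q a = p j + b (V 0 j) (V 0 a) by apply: qP; rewrite aj A0 AJ.
  have N1 := N_up m_gt0 yz; have N2 := N_up m_gt0 (E_sub az).
  have ry := pr _ _ yz (AJ _ _ Jy) (AJ _ _ Jz).
  have ra := pr _ _ (E_sub az) (AJ _ _ Ja) (AJ _ _ Jz).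
  have sq : b (V 0 y) (V 0 j) + b (V 0 j) (V 0 a) - p a + p y = 1.
    have := b_square (N_level0 yj) (N_level0 ja) N2 (N_sym N1).
    by have := b_anti N2; move: ra ry; clear; lia.
  by have := b_anti (N_level0 yj); move: qy qa sq; clear; lia.
(* The extra neighbour [d] is needed because [yz] itself may be missing on level 0. *)
have qy : q y = p d + b (V 0 d) (V 0 y) by apply: qP; rewrite yd !AJ.
have qa : q a = p z + b (V 0 z) (V 0 a) by apply: qP; rewrite az !AJ.
have qj : q j = p y + b (V 0 y) (V 0 j) by apply: qP; rewrite jy A1 AJ.
have qj' : q j = p a + b (V 0 a) (V 0 j) by apply: qP; rewrite ja A1 AJ.
have Nja := N_up m_gt0 (E_sub ja); have Njy := N_up m_gt0 (E_sub jy).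
have Nza := N_up m_gt0 (E_sub za); have Nzy := N_up m_gt0 zy.
have Ndy := N_up m_gt0 (E_sub dy).
have ra := pr _ _ (E_sub za) (AJ _ _ Jz) (AJ _ _ Ja).
have ry := pr _ _ (E_sub dy) (AJ _ _ Jd) (AJ _ _ Jy).
have rz := pr _ _ zy (AJ _ _ Jz) (AJ _ _ Jy).
have sqa : b (V 0 j) (V 1 a) - r a + q a - p a + q j = 2.
  have := b_square Nja (N_sym Nza) (N_level0 za) (N_level0 aj).
  by move: qa qj' ra; clear; lia.
have sqy : b (V 0 j) (V 1 y) - r y + q y - p y + q j = 2.
  have := b_square Njy (N_sym Ndy) (N_level0 dy) (N_level0 yj).
  by move: qy qj ry; clear; lia.
have sqz : b (V 0 j) (V 1 a) - r a = b (V 0 j) (V 1 y) - r y.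
  have := b_square Nja (N_sym Nza) Nzy (N_sym Njy).
  have := b_anti Njy; have := b_anti Nzy.
  by move: ra rz; clear; lia.
by move: sqa sqy sqz; clear; lia.
Qed.

End Potential.

(** * Putting deleted edges back *)

Lemma set2_edge (G : sgraph) (x y : G) : adj x y -> [set x; y] \in edges G.
Proof. by move=> xy; apply/imsetP; exists (x, y); rewrite ?inE. Qed.

Lemma edgeP (G : sgraph) (e : {set G}) :
  e \in edges G -> exists x y : G, adj x y /\ e = [set x; y].
Proof. by case/imsetP=> -[x y]; rewrite inE => xy ->; exists x, y. Qed.

Section Bounds.
Variables (G : sgraph) (B : {set {set G}}) (s : G -> bool).
Hypothesis tf : triangle_free G.
Hypothesis sB : B \subset edges G.

(** This is [G - B] with the edges of [D] put back. *)
Let K (D : {set {set G}}) : rel G := fun x y => adj x y && ([set x; y] \notin B :\: D).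

Let K_sym D : symmetric (K D).
Proof. by move=> x y; rewrite /K adj_sym setUC. Qed.

Let K_irr D : irreflexive (K D).
Proof. by move=> x; rewrite /K adj_irrefl. Qed.

Let K_tf D x y z : K D x y -> K D y z -> K D x z -> False.
Proof.
by move=> /andP[xy _] /andP[yz _] /andP[xz _]; move: (tf x y z); rewrite xy yz xz.
Qed.

Let c_le_K D : three_colorable (K D) -> c G <= #|B :\: D|.
Proof. by apply: c_le_three_colorable => //; apply: subset_trans sB; apply: subsetDl. Qed.

(** On a monochromatic edge this is its side; being defined on every edge, it allows a pigeonhole
    argument. *)
Let all_true (e : {set G}) := [forall w in e, s w].

Let all_true2 x y : s x = s y -> s x = all_true [set x; y].
Proof.
move=> sxy; apply/idP/forall_inP => [sx w /set2P[]-> //|/(_ x)]; first by rewrite -sxy.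
by rewrite set21; apply.
Qed.

(** Edges of [D] pass through [v], so off [v] only [e1] and [e2] can become monochromatic, and then
    on the same side. *)
Lemma c_le_vertex (v : G) (D : {set {set G}}) (e1 e2 : {set G}) :
    (forall x y : G, adj x y -> x != v -> y != v -> [set x; y] \notin B -> s x != s y) ->
    (forall e, e \in D -> v \in e) -> all_true e1 = all_true e2 ->
  c G <= #|B :\: (D :|: [set e1; e2])|.
Proof.
move=> sP Dv e12; apply: c_le_K.
apply: (@three_colorable_vertex _ _ (@K_sym _) (@K_irr _) (@K_tf _) s v e1 e2 (all_true e1)).
move=> x y /andP[xy nF] xv yv sxy.
have inB : [set x; y] \in B.
  by apply/negPn/negP => /(sP _ _ xy xv yv); rewrite sxy eqxx.
move: nF; rewrite inE inB andbT negbK => /setUP[/Dv|].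
  by rewrite !inE ![v == _]eq_sym (negPf xv) (negPf yv).
by case/set2P=> e; rewrite (all_true2 sxy) e; [split; [|left] | split; [|right]].
Qed.

Let three_edges : 2 < #|B| -> exists e1 e2 e3, [/\ e1 \in B, e2 \in B & e3 \in B] /\
  [/\ e1 != e2, e1 != e3, e2 != e3 & all_true e1 = all_true e2].
Proof.
case/card_gt2P=> a [b [d [[aB bB dB] [ab bd da]]]].
have [?|] := eqVneq (all_true a) (all_true b).
  by exists a, b, d; rewrite aB bB dB ab [a == d]eq_sym da bd.
have [?|] := eqVneq (all_true b) (all_true d).
  by exists b, d, a; rewrite aB bB dB bd [b == a]eq_sym ab da.
have [?|] := eqVneq (all_true d) (all_true a).
  by exists d, a, b; rewrite aB bB dB da [d == b]eq_sym bd ab.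
by case: (all_true a); case: (all_true b); case: (all_true d).
Qed.

Let cardD (D : {set {set G}}) : D \subset B -> #|B :\: D| = #|B| - #|D|.
Proof. by move=> /setIidPr DB; rewrite cardsD DB. Qed.

Lemma c_le_bipartite : 2 < #|B| ->
    (forall x y : G, adj x y -> [set x; y] \notin B -> s x != s y) ->
  c G + 3 <= #|B|.
Proof.
move=> B3 sP; have [e1 [e2 [e3 [[B1 B2 Be3] [n12 n13 n23 e12]]]]] := three_edges B3.
(* With no vertex prescribed, [v] is taken on [e3], so that [e3] can be put back too. *)
have [v [w [_ e3E]]] := edgeP (subsetP sB _ Be3).
have := @c_le_vertex v [set e3] e1 e2; rewrite cardD; last first.
  by apply/subsetP => e; rewrite !inE => /or3P[] /eqP->.
rewrite cardsU1 cards2 n12 !inE negb_or ![e3 == _]eq_sym n13 n23 => H.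
have {H} : c G <= #|B| - 3.
  apply: H => //; first by move=> x y xy _ _; apply: sP.
  by move=> e /set1P ->; rewrite e3E set21.
lia.
Qed.

Lemma c_le_bipartite_vertex (v : G) : 2 < #|B| ->
    (forall x y : G, adj x y -> x != v -> y != v -> [set x; y] \notin B -> s x != s y) ->
  c G + 2 <= #|B|.
Proof.
move=> B3 sP; have [e1 [e2 [e3 [[B1 B2 Be3] [n12 n13 n23 e12]]]]] := three_edges B3.
have := @c_le_vertex v set0 e1 e2 sP; rewrite set0U cardD; last first.
  by apply/subsetP => e; rewrite !inE => /orP[] /eqP->.
rewrite cards2 n12 => H; have {H} : c G <= #|B| - 2 by apply: H => // e; rewrite inE.
lia.
Qed.

Lemma c_le_bipartite_two_vertices (v w : G) : 0 < #|B| ->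
    (forall x y : G, adj x y -> x \notin [set v; w] -> y \notin [set v; w] ->
       [set x; y] \notin B -> s x != s y) ->
    (forall y z a b : G, [/\ y \notin [set v; w], z \notin [set v; w],
         a \notin [set v; w] & b \notin [set v; w]] ->
       [/\ adj y v && ([set y; v] \notin B), adj v a && ([set v; a] \notin B),
           adj a z && ([set a; z] \notin B) & adj y b && ([set y; b] \notin B)] ->
       adj y z -> s y != s z) ->
  c G + 1 <= #|B|.
Proof.
move=> /card_gt0P[e eB] sP hex; have : c G <= #|B :\: [set e]|.
  apply: c_le_K; apply: (@three_colorable_two_vertices _ _ (@K_sym _) (@K_irr _) (@K_tf _) s v w e).
    move=> x y /andP[xy nF] xv yv sxy; move: nF; rewrite inE in_set1 negb_and negbK.
    by case/orP=> [/eqP //|/(sP _ _ xy xv yv)]; rewrite sxy eqxx.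
  move=> y z a b [yN zN aN bN] [yz yv va az yb] syz saz sby.
  have vvw : v \in [set v; w] by rewrite set21.
  (* A monochromatic [yz] must be the restored edge [e], so an edge with an end outside [yz] is in
     [G - B]. *)
  have edge p q : K [set e] p q -> p \notin [set y; z] \/ q \notin [set y; z] ->
      adj p q && ([set p; q] \notin B).
    case/andP=> -> nF pqN; apply/negP => inB; move: nF; rewrite inE inB andbT negbK.
    move=> /set1P e1; have e2 : [set y; z] = e.
      case/andP: yz => ayz; rewrite inE in_set1 negb_and negbK.
      by case/orP=> [/eqP //|/(sP _ _ ayz yN zN)]; rewrite syz eqxx.
    by move: pqN; rewrite e2 -e1 set21 set22; case.
  have vN : v \notin [set y; z].
    by apply/negP => /set2P[] e1; move: yN zN; rewrite -e1 vvw.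
  have aNyz : a \notin [set y; z].
    by apply/negP => /set2P[] e1; move: saz; rewrite e1 ?syz eqxx.
  have bNyz : b \notin [set y; z].
    by apply/negP => /set2P[] e1; move: sby; rewrite e1 -?syz eqxx.
  suff : s y != s z by rewrite syz eqxx.
  apply: (hex y z a b) => //.
  - by split; apply: edge => //; auto.
  - by case/andP: yz.
rewrite cardD ?sub1set // cards1; have : 0 < #|B| by apply/card_gt0P; exists e.
lia.
Qed.

End Bounds.

(** * From the Mycielski graph down to the base graph *)

Section Lift.
Variables (G : sgraph) (m : nat) (F : {set {set mycielski m G}}).
Hypothesis m_gt0 : 0 < m.
Hypothesis sF : F \subset edges (mycielski m G).
Hypothesis cF : is_cover_graph (del_edges F).
Hypothesis tf : triangle_free G.

Let V (i : nat) (x : G) : mycielski m G := Some (inord i, x).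
Let u : mycielski m G := None.

Let proj (e : {set mycielski m G}) : {set G} := [set x | [exists i, Some (i, x) \in e]].

Lemma proj_set2 i k (x y : G) : proj [set Some (i, x); Some (k, y)] = [set x; y].
Proof.
apply/setP => z; rewrite !inE; apply/existsP/orP => [[j]|[]/eqP->].
- by rewrite !inE => /orP[] /eqP [_ ->]; rewrite eqxx; [left | right].
- by exists i; rewrite set21.
- by exists k; rewrite set22.
Qed.

Let Fu := [set e in F | u \in e].
Let Fn := [set e in F | u \notin e].
Let Fl := [set e in F | [forall p in e, if p is Some (i, _) then i == 0 :> nat else false]].
Let J := [set x | [set V m x; u] \in F].

Lemma adj_level (i : nat) (x y : G) : i < m -> adj x y ->
  @adj (mycielski m G) (V i x) (V i.+1 y).
Proof. by move=> im xy; rewrite /= xy !inordK ?eqxx ?orbT //; lia. Qed.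

Lemma adj_level0 (x y : G) : adj x y -> @adj (mycielski m G) (V 0 x) (V 0 y).
Proof. by move=> xy; rewrite /= xy !inordK. Qed.

Lemma adj_top (x : G) : @adj (mycielski m G) (V m x) u.
Proof. by rewrite /= inordK. Qed.

Let card_J : #|J| <= #|Fu|.
Proof.
have inj : injective (fun x : G => [set V m x; u]).
  move=> x y e; have : V m x \in [set V m y; u] by rewrite -e set21.
  by case/set2P=> // -[].
rewrite -(card_imset _ inj); apply/subset_leq_card/subsetP => e /imsetP[x].
by rewrite inE => xF ->; rewrite inE xF set22.
Qed.

Let card_F : #|F| = #|Fu| + #|Fn|.
Proof.
rewrite -(cardsID [set e : {set mycielski m G} | u \in e] F); congr (_ + _); apply: eq_card => e.
  by rewrite !inE.
by rewrite !inE andbC.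
Qed.

Let Fl_sub : Fl \subset Fn.
Proof.
apply/subsetP => e; rewrite !inE => /andP[-> /forall_inP H] /=.
by apply/negP => /H.
Qed.

Let proj_edges : proj @: Fn \subset edges G.
Proof.
apply/subsetP => e /imsetP[f]; rewrite inE => /andP[fF uf] ->.
have [p [q [pq fE]]] := edgeP (subsetP sF _ fF); subst f.
case: p q pq uf {fF} => [[i x]|] [[k y]|] pq; rewrite !inE ?eqxx ?orbT //= => _.
by rewrite proj_set2; apply: set2_edge; case/andP: pq.
Qed.

(** Level 0 is a copy of [G]. The order restricted to it may have new covers, hence the use of
    [is_cover_graph_of_order]. *)
Let level0_bound : c G <= #|proj @: Fl|.
Proof.
apply: c_le.
  by apply: subset_trans proj_edges; apply: imsetS.
case: cF => d [P [f [_ fP]]].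
pose R : rel G := fun x y => (f (V 0 x) < f (V 0 y))%O.
have adjF x y : @adj (del_edges (proj @: Fl)) x y -> @adj (del_edges F) (V 0 x) (V 0 y).
  case/andP=> xy nF; apply/andP; split; first exact: adj_level0.
  apply/negP => inF; case/imsetP: nF; exists [set V 0 x; V 0 y]; last by rewrite proj_set2.
  by rewrite inE inF /=; apply/forall_inP => p /set2P[]-> /=; rewrite inordK.
apply: (@is_cover_graph_of_order (del_edges (proj @: Fl)) R).
- by move=> y x z; apply: Order.POrderTheory.lt_trans.
- by move=> x; apply: Order.POrderTheory.ltxx.
- by move=> x y /adjF; rewrite fP => /orP[] /andP[lt _]; rewrite /R lt ?orbT.
- move=> x y z /adjF; rewrite fP => /orP[] /andP[lt nex] xz zy.
    by move: nex => /existsP[]; exists (f (V 0 z)); apply/andP.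
  by have := Order.POrderTheory.lt_trans (Order.POrderTheory.lt_trans xz zy) lt;
     rewrite Order.POrderTheory.ltxx.
Qed.

Let E : rel G := fun x y => adj x y && ([set x; y] \notin proj @: Fn).

(** [U] is left open: it will be all of [adj] when [F] has no edge between levels, and [E]
    otherwise. *)
Let lift_coloring (U : rel G) : symmetric U -> (forall x y, E x y -> U x y) ->
    (forall x y, U x y -> adj x y) ->
    (forall i x y, i < m -> U x y -> [set V i x; V i.+1 y] \notin F) ->
  exists s : G -> bool,
  (forall x y, E x y -> x \notin J -> y \notin J -> s x != s y) /\
  (forall j y z p q, [/\ y \notin J, z \notin J, p \notin J & q \notin J] ->
     [/\ E y j, E j p, E p z & E y q] -> U y z -> s y != s z).
Proof.
move=> Us EU Ua UF; case: cF => d [P [f [_ fP]]].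
pose N p q := @adj (del_edges F) p q : Prop.
pose b (p q : mycielski m G) : int := Posz (f p < f q)%O.
apply: (@level0_coloring _ _ N b _ _ _ V u m U E (mem J)) => //.
- by move=> p q; rewrite /N adj_sym.
- move=> p q; rewrite /N fP /b => /orP[] /andP[lt _];
  by rewrite lt Order.POrderTheory.lt_gtF.
- move=> p q r t pq qr rt tp; have := cover_square fP pq qr rt tp.
  by rewrite /b; lia.
- by move=> x y; rewrite /E adj_sym setUC.
- move=> x y /andP[xy nF]; apply/andP; split; first exact: adj_level0.
  apply/negP => inF; case/imsetP: nF; exists [set V 0 x; V 0 y]; last by rewrite proj_set2.
  by rewrite !inE inF.
- move=> i x y im xy; apply/andP; split; last exact: UF.
  by apply: adj_level => //; apply: Ua.
- move=> x xJ; apply/andP; split; first exact: adj_top.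
  by move: xJ; rewrite /= inE.
Qed.

Lemma card_deleted : 3 <= c G -> c G + 3 <= #|F|.
Proof.
move=> c3; rewrite leqNgt; apply/negP => F_lt.
have ln : #|Fl| <= #|Fn| := subset_leq_card Fl_sub.
have Bl : #|proj @: Fl| <= #|Fl| := leq_imset_card proj Fl.
have Bn : #|proj @: Fn| <= #|Fn| := leq_imset_card proj Fn.
have B_ln : #|proj @: Fl| <= #|proj @: Fn| by apply: subset_leq_card; apply: imsetS.
have J2 : #|J| <= 2 by move: card_J card_F level0_bound; lia.
have EN x y : E x y -> forall i k, [set Some (i, x); Some (k, y)] \notin F.
  case/andP=> _ nF i k; apply/negP => inF; case/imsetP: nF.
  by exists [set Some (i, x); Some (k, y)]; rewrite ?proj_set2 // !inE inF.
have [J_eq2|J_ne2] := eqVneq #|J| 2.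
  (* Two apex edges leave at most [c G] others, and level 0 already accounts for that many. *)
  have FnE : Fl = Fn.
    by apply/eqP; rewrite eqEcard Fl_sub; move: card_J card_F level0_bound; lia.
  have [|x y /andP[] //|//|i x y im xy|s [sP hex]] := @lift_coloring (@adj G).
  - exact: adj_sym.
  - apply/negP => inF; have : [set V i x; V i.+1 y] \in Fl by rewrite FnE !inE inF.
    by rewrite inE inF => /forall_inP/(_ (V i.+1 y)); rewrite set22 /= inordK // => /(_ isT).
  have /cards2P[v [w [_ JE]]] : #|J| == 2 by rewrite J_eq2.
  rewrite JE in sP hex.
  have := @c_le_bipartite_two_vertices G _ s tf proj_edges v w.
  have B_gt0 : 0 < #|proj @: Fn| by move: level0_bound; lia.
  move/(_ B_gt0) => H; have : c G + 1 <= #|proj @: Fn|.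
    apply: H => [x y xy xJ yJ nB|y z a b]; first by apply: sP; rewrite // /E xy.
    exact: hex.
  (* The two apex edges make up the difference between 1 and 3; below, a single one makes up that
     between 2 and 3. *)
  by move: card_J card_F; lia.
have [|//|x y /andP[] //|i x y im xy|s [sP _]] := @lift_coloring E.
- by move=> x y; rewrite /E adj_sym setUC.
- exact: EN.
(* Here [c G >= 3] supplies the three edges for the pigeonhole argument. *)
have B3 : 2 < #|proj @: Fn| by move: level0_bound; lia.
have [J0|] := posnP #|J|.
  have : c G + 3 <= #|proj @: Fn|.
    apply: (@c_le_bipartite G _ s) => // x y xy nB.
    by apply: sP; rewrite ?(cards0_eq J0) ?inE // /E xy.
  by move: card_F; lia.
move=> J_gt0; have /cards1P[v JE] : #|J| == 1 by move: J2 J_ne2 J_gt0; lia.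
have : c G + 2 <= #|proj @: Fn|.
  apply: (@c_le_bipartite_vertex G _ s _ _ v) => // x y xy xv yv nB.
  by apply: sP; rewrite ?JE ?inE // /E xy.
by move: card_J card_F; lia.
Qed.

End Lift.

Theorem corollary16 (G : sgraph) (m : nat) (m_ge1 : 1 <= m)
    (G_triangle_free : triangle_free G)
    (G_edges : 3 <= #|edges G|)
    (cG_ge3 : 3 <= c G) :
  c (mycielski m G) >= c G + 3.
Proof.
have [F <- [sF cF]] := c_attained (mycielski m G).
exact: card_deleted.
Qed.
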